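(* The value function $V_\infty$ of $(OCP)_\infty$ satisfies the Hamilton–Jacobi–Bellman equation $$\nabla V_\infty(x)^\top J_nx-\frac{q-1}{q}\left|\frac{\partial V_\infty}{\partial x_n}(x)\right|^{\frac{q}{q-1}}+F(x)=0,\qquad\forall x\in\mathbb{R}^n.$$
   Context: Let $n\ge 1$ be an integer and $q\in(1,\infty)$. $J_n$ is the $n\times n$ Jordan block with eigenvalue $0$ (ones on the superdiagonal, zeros elsewhere) and $e_n$ is the last canonical basis vector of $\mathbb{R}^n$. The control system is $\dot x=J_nx+e_nu$. The function $F:\mathbb{R}^n\to\mathbb{R}_{\ge 0}$ is continuously differentiable, convex and positive definite ($F(0)=0$, $F(x)>0$ for $x\ne0$). For $x_0\in\mathbb{R}^n$ and $u\in L^q(\mathbb{R}_{\ge0},\mathbb{R})$, $\mathcal{J}_\infty(x_0,u)=\int_0^\infty\left(\frac{|u(t)|^q}{q}+F(x(t))\right)dt$, where $x(\cdot)$ is the trajectory of the control system with $x(0)=x_0$ and control $u$. $(OCP)_\infty$ is the problem of minimizing $\mathcal{J}_\infty(x_0,\cdot)$ over $L^q(\mathbb{R}_{\ge0},\mathbb{R})$ and $V_\infty(x_0)=\inf_{u\in L^q(\mathbb{R}_{\ge0},\mathbb{R})}\mathcal{J}_\infty(x_0,u)$ is its value function, which is continuously differentiable on $\mathbb{R}^n$. *)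

(* Defs.v *)
From HB Require Import structures.
From mathcomp Require Import all_boot all_order all_algebra.
From mathcomp Require Import all_classical all_reals all_analysis.

Set Implicit Arguments.
Unset Strict Implicit.
Unset Printing Implicit Defensive.

Import Order.TTheory GRing.Theory Num.Theory.
Import numFieldNormedType.Exports.

Local Open Scope classical_set_scope.
Local Open Scope ring_scope.

Section Defs.
Context {R : realType}.
Local Notation mu := (@lebesgue_measure R).

Definition jordan_block (n : nat) : 'M[R]_n :=
  \matrix_(i, j) ((j == i.+1 :> nat)%:R).

(* With 0-based indices, the last basis vector has index n.-1. *)
Definition e_last (n : nat) : 'cV[R]_n := \col_i ((i == n.-1 :> nat)%:R).

Definition grad (n : nat) (f : 'cV[R]_n -> R) (x : 'cV[R]_n) : 'cV[R]_n :=
  \col_i 'D_(delta_mx i 0) f x.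

Definition C1 (n : nat) (f : 'cV[R]_n -> R) : Prop :=
  (forall x, differentiable f x) /\ continuous (grad f).

Definition positive_definite (n : nat) (f : 'cV[R]_n -> R) : Prop :=
  f 0 = 0 /\ forall x, x != 0 -> 0 < f x.

(* L^q(R_{>=0}, R): only the restriction of u to [0, +oo[ matters. *)
Definition Lq_control (q : R) (u : R -> R) : Prop :=
  u \_ `[0, +oo[ \in Lfun mu q%:E.

(* Caratheodory solution of x' = J_n x + e_n u, x(0) = x0, on [0, +oo[: since
   u is only L^q, the equation is meant in integrated form. *)
Definition trajectory (n : nat) (x0 : 'cV[R]_n) (u : R -> R)
    (x : R -> 'cV[R]_n) : Prop :=
  {within `[0, +oo[, continuous x} /\
  forall t, 0 <= t -> forall i,
    x t i 0 = x0 i 0 +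
      \int[mu]_(s in `[0, t]) (jordan_block n *m x s + u s *: e_last n) i 0.

Definition cost (n : nat) (q : R) (F : 'cV[R]_n -> R) (u : R -> R)
    (x : R -> 'cV[R]_n) : \bar R :=
  (\int[mu]_(t in `[0%R, +oo[) (`|u t| `^ q / q + F (x t))%:E)%E.

(* The trajectory exists and is determined on [0, +oo[ by (x0, u), so this
   infimum over pairs is the infimum over u of J_infty(x0, u). *)
Definition V_infty_ext (n : nat) (q : R) (F : 'cV[R]_n -> R)
    (x0 : 'cV[R]_n) : \bar R :=
  ereal_inf [set c | exists u x,
    [/\ Lq_control q u, trajectory x0 u x & c = cost q F u x]].

(* The infimum is finite, the system being controllable to 0 in finite time. *)
Definition V_infty (n : nat) (q : R) (F : 'cV[R]_n -> R) (x0 : 'cV[R]_n) : R :=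
  fine (V_infty_ext q F x0).

End Defs.

Arguments jordan_block : clear implicits.
Arguments e_last : clear implicits.

(* Main.v *)
Require Import Defs.
From HB Require Import structures.
From mathcomp Require Import all_boot all_order all_algebra.
From mathcomp Require Import all_classical all_reals all_analysis.
From mathcomp Require Import measurable_realfun real_interval ring lra.
Import Order.TTheory GRing.Theory Num.Theory.
Import numFieldNormedType.Exports.
Local Open Scope classical_set_scope.
Local Open Scope ring_scope.

Set Implicit Arguments.
Unset Strict Implicit.
Unset Printing Implicit Defensive.

(** Dynamic programming on a short interval [0, h], in two directions.  Write p
    for the gradient of V at x0 and pn for its last coordinate.
    - Applying a constant control c on [0, h] gives
      0 <= |c|^q/q + F(x0) + p.(J x0 + c e) + o(1); taking the c that realizes
      equality in Young's inequality gives the inequality ">= 0".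
    - A control u that is optimal up to h d has int |u|^q bounded independently
      of h, hence its trajectory tends to x0 uniformly as h -> 0.  Only the
      differentiability of V at x0 is used (no chain rule along the absolutely
      continuous trajectory): the remainder d |x(h) - x0| is O(d (h + int |u|)),
      and the part d int |u|, which need not be O(h), is absorbed by Young's
      inequality with |pn| + 2 d in place of |pn|.  Letting d -> 0 gives
      "<= 0".
    Finiteness of V comes from steering x0 to 0 in unit time along (y, y', ...,
    y^(n-1)) for a polynomial y with prescribed jets at 0 and 1. *)

(** * Translations and integrals *)

Section Translation.
Variable R : realType.
Notation mu := (@lebesgue_measure R).

Lemma measurable_addr (c : R) : measurable_fun [set: R] (fun t => t + c).
Proof. by exact: measurable_realfun.measurable_funD. Qed.

(** By uniqueness of Lebesgue measure: its image under the translation gives half-open intervals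
    their usual length. *)
Lemma lebesgue_measure_translation (c : R) (A : set R) :
  measurable A -> mu ((fun t => t + c) @^-1` A) = mu A.
Proof.
move=> mA; pose f : R -> R := fun t => t + c.
have mf : measurable_fun [set: measurableTypeR R]
    (f : measurableTypeR R -> measurableTypeR R) := measurable_addr c.
pose fP := isMeasurableFun.Build _ _ _ _ _ mf.
pose F : {mfun measurableTypeR R >-> measurableTypeR R} := HB.pack f fP.
rewrite [RHS](@lebesgue_measure_unique R (pushforward mu F))//.
move=> X [[a b]/= _ <-].
rewrite /pushforward (_ : F @^-1` _ = `]a - c, b - c]%classic).
  by rewrite !lebesgue_measure_itv/= !lte_fin ltrD2r -!EFinD; case: ifP => // _;
    congr EFin; lra.
by apply/seteqP; split => x /=; rewrite !in_itv/= /f; lra.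
Qed.

(** The nonnegative case is the pushforward formula, the translation preserving [mu]. The general
    case follows from positive and negative parts, so no integrability has to be assumed. *)
Lemma integral_translation (c : R) (D : set R) (f : R -> \bar R) :
  measurable D -> measurable_fun D f ->
  (\int[mu]_(t in D) f t = \int[mu]_(t in (fun t => t + c)%R @^-1` D) f (t + c)%R)%E.
Proof.
move=> mD mf; pose g : R -> R := fun t => t + c.
have key (h : R -> \bar R) : measurable_fun D h -> (forall t, 0 <= h t)%E ->
    (\int[mu]_(t in D) h t = \int[mu]_(t in g @^-1` D) (h \o g) t)%E.
  move=> mh h0.
  rewrite -(@ge0_integral_pushforward _ _ (measurableTypeR R)
    (measurableTypeR R) R g (measurable_addr c) mu)//.
  apply: eq_measure_integral => [|? A mA _]; first exact: measurable_addr.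
  exact/esym/lebesgue_measure_translation.
rewrite integralE [RHS]integralE (_ : (fun t => f (t + c)) = f \o g)//.
rewrite (key _ (measurable_funepos mf) (funepos_ge0 f)).
by rewrite (key _ (measurable_funeneg mf) (funeneg_ge0 f)) -funepos_comp -funeneg_comp.
Qed.
End Translation.
Section RealIntegrable.
Variable R : realType.
Notation mu := (@lebesgue_measure R).
Implicit Types (D : set R) (f g : R -> R).

Lemma integrable_addr D f g : measurable D ->
  mu.-integrable D (EFin \o f) -> mu.-integrable D (EFin \o g) ->
  mu.-integrable D (EFin \o (fun t => f t + g t)).
Proof. by move=> mD If Ig; exact: (integrableD _ If Ig). Qed.

Lemma integrable_mulrl D (k : R) f : measurable D ->
  mu.-integrable D (EFin \o f) ->
  mu.-integrable D (EFin \o (fun t => k * f t)).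
Proof. by move=> mD If; exact: (integrableZl _ k If). Qed.

Lemma integrable_itv_cst (a b k : R) : mu.-integrable `[a, b] (EFin \o cst k).
Proof.
apply: continuous_compact_integrable; first exact: segment_compact.
by apply: continuous_subspaceT; exact: cst_continuous.
Qed.

Lemma Rintegral_itv_cst (h k : R) : 0 <= h -> \int[mu]_(t in `[0, h]) k = k * h.
Proof.
move=> h0; rewrite Rintegral_cst//; congr (_ * _).
apply: (etrans (congr1 fine (lebesgue_measure_itv `[0, h]))); rewrite /= lte_fin.
by case: ltP => [_|hle] /=; [rewrite subr0|have -> : h = 0 by lra].
Qed.
End RealIntegrable.

(** * Cutting and gluing at a time [h] *)

Section Splitting.
Variable R : realType.
Notation mu := (@lebesgue_measure R).
Implicit Types (f : R -> R) (g : R -> \bar R).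

(** Stated on interval bounds, so that segments and half-lines are covered at once. *)
Lemma preimage_addr_itv (c : R) (a b : itv_bound R) :
  (fun t => t + c) @^-1` [set` Interval a b] =
  [set` Interval (match a with BSide s x => BSide s (x - c) | BInfty s => BInfty _ s end)
                 (match b with BSide s x => BSide s (x - c) | BInfty s => BInfty _ s end)].
Proof.
apply/seteqP; split => x /=; rewrite !itv_boundlr;
  by case: a => [[] a|[]]; case: b => [[] b|[]]; rewrite !bnd_simp
    ?lerBrDr ?ltrBrDr ?lerBlDr ?ltrBlDr.
Qed.

Lemma measurable_fun_shift (c : R) d (T : measurableType d) (D : set R) (f : R -> T) :
  measurable D -> measurable_fun D f ->
  measurable_fun ((fun t => t + c) @^-1` D) (fun t => f (t + c)).
Proof.
move=> mD mf; apply: (@measurable_comp _ _ _ _ _ _ D) => //.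
  by move=> _ [x Dx <-].
by apply: measurable_funTS; exact: measurable_addr.
Qed.

(** Meant for the cost: its integrand is nonnegative, hence an infinite value is allowed. The
    real-valued [Rintegral_split] serves the state equation instead. *)
Lemma ge0_integral_split (h : R) g : 0 <= h ->
  measurable_fun `[(0:R), +oo[ g -> (forall t, 0 <= g t)%E ->
  (\int[mu]_(t in `[0%R, +oo[) g t =
   \int[mu]_(t in `[0%R, h]) g t + \int[mu]_(t in `[0%R, +oo[) g (t + h)%R)%E.
Proof.
move=> h0 mg g0.
have E : `[(0:R), +oo[%classic = `[0, h[%classic `|` `[h, +oo[%classic.
  by rewrite -itv_bndbnd_setU.
have [mg1 mg2] : measurable_fun `[(0:R), h[ g /\ measurable_fun `[(h:R), +oo[ g.
  by apply/measurable_funU => //; rewrite -E.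
rewrite {1}E ge0_integral_setU//=; last 2 first.
- by rewrite -E.
- apply/disj_setPS => t [] /=; rewrite !in_itv/= andbT => /andP[_ th] ht.
  by move: th; rewrite ltNge ht.
(* The disjoint pieces are [[0, h[] and [[h, +oo[]; closing the first one adds a null set. *)
rewrite integral_itv_bndo_bndc//; congr (_ + _)%E.
by rewrite (integral_translation h) // preimage_addr_itv subrr.
Qed.

Lemma Rintegral_split (h t : R) f : 0 <= h -> 0 <= t ->
  mu.-integrable `[(0:R), t + h] (EFin \o f) ->
  \int[mu]_(s in `[0, t + h]) f s =
  \int[mu]_(s in `[0, h]) f s + \int[mu]_(s in `[0, t]) f (s + h).
Proof.
move=> h0 t0 intf.
have E : `[(0:R), t + h]%classic = `[0, h[%classic `|` `[h, t + h]%classic.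
  by rewrite -itv_bndbnd_setU// bnd_simp // lerDr.
have hs : `[0, h[ `<=` `[0, t + h].
  by move=> s /=; rewrite !in_itv/=; lra.
rewrite E Rintegral_setU//=; last 2 first.
- by rewrite -E.
- apply/disj_setPS => s [] /=; rewrite !in_itv/= => /andP[_ th] /andP[ht _].
  by move: th; rewrite ltNge ht.
rewrite Rintegral_itv_bndo_bndc//; last exact: integrableS intf.
congr (_ + _); rewrite /Rintegral (integral_translation h) //; last first.
  have := measurable_int _ intf; apply: measurable_funS => //.
  by rewrite E; exact: subsetUr.
by rewrite preimage_addr_itv subrr addrK.
Qed.

Lemma measurable_fun_glue (h : R) d (T : measurableType d) (f : R -> T) : 0 <= h ->
  measurable_fun `[(0:R), h] f -> measurable_fun `[(0:R), +oo[ (fun t => f (t + h)) ->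
  measurable_fun `[(0:R), +oo[ f.
Proof.
move=> h0 mf1 mf2.
rewrite (_ : `[(0:R), +oo[%classic = `[0, h]%classic `|` `[h, +oo[%classic); last first.
  apply/seteqP; split=> t /=; rewrite !in_itv/= !andbT; last lra.
  by move=> ->/=; case: (leP t h) => [|/ltW]; auto.
apply/measurable_funU => //; split => //.
have := @measurable_fun_shift (- h) _ _ _ _ (measurable_itv _) mf2.
rewrite preimage_addr_itv sub0r opprK.
apply: eq_measurable_fun => t _.
by rewrite subrK.
Qed.

Lemma within_continuous_shift (h : R) (T : topologicalType) (D : set R) (f : R -> T) :
  {within D, continuous f} ->
  {within (fun t => t + h) @^-1` D, continuous (fun t => f (t + h))}.
Proof.
move=> cf; apply/continuousP => U oU.
have /open_subspaceP[V oV VD] := (continuousP _).1 cf _ oU.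
apply/open_subspaceP; exists ((fun t => t + h) @^-1` V).
  by apply: open_comp => // x _; apply: cvgD; [exact: cvg_id|exact: cvg_cst].
exact: (congr1 (preimage (fun t : R => t + h)) VD).
Qed.

Lemma within_continuous_glue (h : R) (T : topologicalType) (f : R -> T) : 0 <= h ->
  {within `[(0:R), h], continuous f} ->
  {within `[(0:R), +oo[, continuous (fun t => f (t + h))} ->
  {within `[(0:R), +oo[, continuous f}.
Proof.
move=> h0 cf1 cf2.
rewrite (_ : `[(0:R), +oo[%classic = `[0, h]%classic `|` `[h, +oo[%classic); last first.
  apply/seteqP; split=> t /=; rewrite !in_itv/= !andbT; last lra.
  by move=> ->/=; case: (leP t h) => [|/ltW]; auto.
apply: withinU_continuous => //; [exact: itv_closed|exact: rray_closed|].
have := within_continuous_shift (h := - h) cf2.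
rewrite preimage_addr_itv sub0r opprK.
by rewrite (_ : (fun t : R => f (t - h + h)) = f)//; apply/funext => t; rewrite subrK.
Qed.
End Splitting.

(** * Controls and trajectories *)

Section Controls.
Variables (R : realType) (q : R).
Hypothesis hq : 1 < q.
Notation mu := (@lebesgue_measure R).
Implicit Types (u : R -> R) (D : set R).

(** Membership in L^q of a set, written without extension by zero and without the q-th root;
    [Lq_controlE] links it to [Lq_control]. *)
Definition Lq_on D u :=
  measurable_fun D u /\ (\int[mu]_(t in D) (`|u t| `^ q)%:E < +oo)%E.

Let q0 : 0 < q. Proof. exact: lt_trans hq. Qed.

(** The extension by zero adds nothing to the integral because [0 < q], and a q-norm is finite
    exactly when its q-th power is. *)
Lemma Lq_controlE u : Lq_control q u <-> Lq_on `[0, +oo[ u.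
Proof.
have E : (\int[mu]_t (`|(u \_ `[0%R, +oo[) t| `^ q)%:E =
          \int[mu]_(t in `[0%R, +oo[) (`|u t| `^ q)%:E)%E.
  rewrite [RHS]integral_mkcond; apply: eq_integral => t _.
  by rewrite /patch; case: ifP => // _; rewrite normr0 powR0// gt_eqF.
have NE : ('N[mu]_q%:E [EFin \o (u \_ `[0%R, +oo[)] =
    (\int[mu]_(t in `[0%R, +oo[) (`|u t| `^ q)%:E) `^ q^-1)%E.
  by rewrite unlock -E; congr (_ `^ _)%E; apply: eq_integral.
rewrite /Lq_control; split.
  move=> /andP[]; rewrite !inE /= => mf; rewrite /finite_norm NE => fin; split.
    by apply/measurable_restrictT => //; exact: mf.
  have := poweR_Lnorm mu (EFin \o (u \_ `[0, +oo[)) (lt0r_neq0 q0).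
  rewrite NE => EE; have := poweR_lty q fin; rewrite EE.
  by rewrite (_ : (\int[mu]_x _)%E = (\int[mu]_(t in `[0%R, +oo[) (`|u t| `^ q)%:E)%E).
move=> [mu_ fin]; apply/andP; rewrite !inE/=; split.
  have := (measurable_restrictT u (measurable_itv `[(0:R), +oo[)).1 mu_. exact.
by rewrite /finite_norm NE; exact: poweR_lty.
Qed.

Lemma measurable_Lq D u : measurable_fun D u ->
  measurable_fun D (fun t => (`|u t| `^ q)%:E).
Proof.
move=> mf; apply/measurable_EFinP.
by apply: (measurableT_comp (measurable_powR q)); exact: measurableT_comp.
Qed.

Lemma Lq_onS D E u : measurable D -> measurable E -> D `<=` E -> Lq_on E u -> Lq_on D u.
Proof.
move=> mD mE DE [mf fin]; split; first exact: measurable_funS mf.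
by apply: le_lt_trans fin; apply: ge0_subset_integral => //; exact: measurable_Lq.
Qed.

(** This elementary bound gives the inclusion of L^q in L^1 on bounded intervals. *)
Lemma ler_1DpowR (a : R) : 0 <= a -> a <= 1 + a `^ q.
Proof.
move=> a0; have [a1|a1] := leP a 1; first by rewrite ler_wpDr ?powR_ge0.
by rewrite ler_wpDl// le1r_powR// ltW.
Qed.

Lemma Lq_on_powR_integrable D u : Lq_on D u -> 
  mu.-integrable D (EFin \o (fun t => `|u t| `^ q)).
Proof.
move=> [mf fin]; apply/integrableP; split; first exact: measurable_Lq.
by under eq_integral do rewrite /= ger0_norm ?powR_ge0//.
Qed.

Lemma Lq_on_integrable (a b : R) u : Lq_on `[a, b] u ->
  mu.-integrable `[a, b] (EFin \o u).
Proof.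
move=> Lu; have [mf _] := Lu.
have I2 : mu.-integrable `[a, b] (EFin \o (fun t => 1 + `|u t| `^ q)).
  by apply: integrable_addr => //; [exact: integrable_itv_cst|exact: Lq_on_powR_integrable].
apply: le_integrable I2 => //; first exact/measurable_EFinP.
by move=> t _ /=; rewrite lee_fin [leRHS]ger0_norm ?ler_1DpowR// addr_ge0// powR_ge0.
Qed.
End Controls.

Lemma ctrl_rhsE (R : realType) (n : nat) (y : 'cV[R]_n) (c : R) (i : 'I_n) :
  (jordan_block R n *m y + c *: e_last R n) i 0 =
  (jordan_block R n *m y) i 0 + c * (i == n.-1 :> nat)%:R.
Proof. by rewrite !mxE. Qed.

(** The Jordan block shifts coordinates; [insub] fails exactly at the last index, where the row is
    zero. *)
Lemma jordan_mulE (R : realType) (n : nat) (y : 'cV[R]_n) (i : 'I_n) :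
  (jordan_block R n *m y) i 0 =
  if insub i.+1 is Some j then y j 0 else 0.
Proof.
rewrite mxE; case: insubP => [j _ ji|ni].
  rewrite (bigD1 j)//= mxE ji eqxx mul1r big1 ?addr0// => k kj.
  by rewrite mxE -ji val_eqE (negbTE kj) mul0r.
rewrite big1// => k _; rewrite mxE; case: eqP => [ki|_]; last by rewrite mul0r.
by move: ni; rewrite -ki ltn_ord.
Qed.

(** * Admissible pairs: restriction, time shift, concatenation *)

Section Trajectories.
Variables (R : realType) (n : nat) (q : R).
Hypothesis hq : 1 < q.
Notation mu := (@lebesgue_measure R).
Notation J := (jordan_block R n).
Notation e := (e_last R n).
Implicit Types (u v : R -> R) (x y : R -> 'cV[R]_n).

Lemma jordan_coord_continuous (i : 'I_n) : continuous (fun y : 'cV[R]_n => (J *m y) i 0).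
Proof.
rewrite (_ : (fun _ => _) = fun y : 'cV[R]_n => if insub i.+1 is Some j then y j 0 else 0).
  case: insub => [j|]; [exact: coord_continuous|exact: cst_continuous].
by apply/funext => y; rewrite jordan_mulE.
Qed.

Lemma jordan_coord_integrable (a b : R) x (i : 'I_n) :
  {within `[a, b], continuous x} ->
  mu.-integrable `[a, b] (EFin \o (fun s => (J *m x s) i 0)).
Proof.
move=> cx; apply: continuous_compact_integrable; first exact: segment_compact.
have H : {within `[a, b], continuous ((fun z : 'cV[R]_n => (J *m z) i 0) \o x)}.
  by apply: within_continuous_comp cx => y _; exact: jordan_coord_continuous.
exact: H.
Qed.

Lemma ctrl_rhs_integrable (a b : R) u x (i : 'I_n) :
  Lq_on q `[a, b] u -> {within `[a, b], continuous x} ->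
  mu.-integrable `[a, b] (EFin \o (fun s => (J *m x s + u s *: e) i 0)).
Proof.
move=> Lu cx.
have -> : (fun s => (J *m x s + u s *: e) i 0) =
   fun s => (J *m x s) i 0 + (i == n.-1 :> nat)%:R * u s.
  by apply/funext => s; rewrite ctrl_rhsE mulrC.
apply: integrable_addr => //; first exact: jordan_coord_integrable.
by apply: integrable_mulrl => //; exact: Lq_on_integrable Lu.
Qed.

Lemma trajectory0 (x0 : 'cV[R]_n) u x : trajectory x0 u x -> x 0 = x0.
Proof.
move=> [_ H]; apply/colP => i; rewrite (H 0 (lexx _)).
by rewrite set_itv1 Rintegral_set1 addr0.
Qed.

(** The local counterpart of [trajectory], with the initial state read off as [x 0]. *)
Definition solves_on (h : R) u x :=
  {within `[(0:R), h], continuous x} /\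
  forall t, 0 <= t <= h -> forall i, x t i 0 = x 0 i 0 +
      \int[mu]_(s in `[0, t]) (J *m x s + u s *: e) i 0.

Lemma admissible_restrict (h : R) (x0 : 'cV[R]_n) u x : 0 <= h ->
  Lq_control q u -> trajectory x0 u x ->
  Lq_on q `[0, h] u /\ solves_on h u x.
Proof.
move=> h0 /(Lq_controlE hq) Lu tx; have x00 := trajectory0 tx.
have sub : `[0, h] `<=` `[0, +oo[ by move=> t /=; rewrite !in_itv/=; lra.
split; first exact: (Lq_onS _ _ sub Lu).
case: tx => cx H; split; first exact: continuous_subspaceW cx.
by move=> t /andP[t0 _] i; rewrite x00 -H.
Qed.

Lemma Lq_on_shift (h : R) u : 0 <= h -> Lq_on q `[0, +oo[ u ->
  Lq_on q `[0, +oo[ (fun t => u (t + h)).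
Proof.
move=> h0 [mu_ fin].
have pre : (fun t => t + h) @^-1` `[h, +oo[ = `[(0:R), +oo[%classic.
  by rewrite preimage_addr_itv subrr.
have sub : `[h, +oo[ `<=` `[0, +oo[ by move=> t /=; rewrite !in_itv/=; lra.
have muh : measurable_fun `[h, +oo[ u by exact: measurable_funS mu_.
split; first by rewrite -pre; exact: measurable_fun_shift.
apply: le_lt_trans fin.
have mq := measurable_Lq q muh.
have := integral_translation h (measurable_itv _) mq; rewrite pre => <-.
by apply: ge0_subset_integral => //; exact: measurable_Lq.
Qed.

(** The system is autonomous, so subtracting the state equation at [h] from the one at [t + h]
    leaves the equation started at [x h]. *)
Lemma admissible_shift (h : R) (x0 : 'cV[R]_n) u x : 0 <= h ->
  Lq_control q u -> trajectory x0 u x ->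
  Lq_control q (fun t => u (t + h)) /\
  trajectory (x h) (fun t => u (t + h)) (fun t => x (t + h)).
Proof.
move=> h0 /(Lq_controlE hq) Lu [cx H].
split; first exact/(Lq_controlE hq)/Lq_on_shift.
split.
  have := within_continuous_shift (h := h) cx; rewrite preimage_addr_itv/=.
  by apply: continuous_subspaceW => t /=; rewrite !in_itv/=; lra.
move=> t t0 i; rewrite !H ?addr_ge0// -addrA; congr (_ + _).
have sub : `[0, t + h] `<=` `[0, +oo[ by move=> s /=; rewrite !in_itv/=; lra.
rewrite (Rintegral_split h0 t0)//; apply: ctrl_rhs_integrable.
  exact: (Lq_onS _ _ sub Lu).
exact: continuous_subspaceW cx.
Qed.

(** Converse of restricting and shifting: before [h] the equation is that of the first piece, and
    after [h] the two integrals add up. *)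
Lemma admissible_glue (h : R) u x : 0 <= h ->
  Lq_on q `[0, h] u -> solves_on h u x ->
  Lq_control q (fun t => u (t + h)) ->
  trajectory (x h) (fun t => u (t + h)) (fun t => x (t + h)) ->
  Lq_control q u /\ trajectory (x 0) u x.
Proof.
move=> h0 [muh finh] [cx H] /(Lq_controlE hq)[mu2 fin2] [cx2 H2].
have mu_ : measurable_fun `[(0:R), +oo[ u by exact: (measurable_fun_glue h0).
have Lu : Lq_on q `[0, +oo[ u.
  split=> //; rewrite (ge0_integral_split h0)//; last exact: measurable_Lq.
  exact: lte_add_pinfty.
split; first exact/(Lq_controlE hq).
have cxx : {within `[(0:R), +oo[, continuous x} by exact: (within_continuous_glue h0).
split => // t t0 i.
have [th|/ltW ht] := leP t h; first by rewrite -H// t0.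
have sub : `[0, t] `<=` `[0, +oo[ by move=> s /=; rewrite !in_itv/=; lra.
have := @Rintegral_split R h (t - h) (fun s => (J *m x s + u s *: e) i 0) h0.
rewrite subr_ge0 subrK => ->//; last first.
  apply: ctrl_rhs_integrable; first exact: (Lq_onS _ _ sub Lu).
  exact: continuous_subspaceW cxx.
have := H2 (t - h); rewrite subr_ge0 subrK => -> //.
by rewrite (H h) ?h0 ?lexx// addrA.
Qed.

End Trajectories.

(** * Dynamic programming *)

Section DynamicProgramming.
Variables (R : realType) (n : nat) (q : R) (F : 'cV[R]_n -> R).
Hypotheses (hq : 1 < q) (cF : continuous F) (F0 : forall y, 0 <= F y).
Notation mu := (@lebesgue_measure R).
Implicit Types (u v : R -> R) (x y : R -> 'cV[R]_n).

Definition running_cost u x (t : R) : R := `|u t| `^ q / q + F (x t).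

Definition cost_on (h : R) u x : \bar R :=
  (\int[mu]_(t in `[0%R, h]) (running_cost u x t)%:E)%E.

Lemma running_cost_ge0 u x t : 0 <= running_cost u x t.
Proof. by rewrite addr_ge0// divr_ge0 ?powR_ge0// ltW// (lt_trans _ hq). Qed.

Lemma cost_on_ge0 (h : R) u x : (0 <= cost_on h u x)%E.
Proof. by apply: integral_ge0 => t _; rewrite lee_fin running_cost_ge0. Qed.

Lemma cost_ge0 u x : (0 <= cost q F u x)%E.
Proof. by apply: integral_ge0 => t _; rewrite lee_fin running_cost_ge0. Qed.

Lemma measurable_running_cost (D : set R) u x : measurable D ->
  measurable_fun D u -> {within D, continuous x} ->
  measurable_fun D (fun t => (running_cost u x t)%:E).
Proof.
move=> mD mu_ cx; apply/measurable_EFinP; apply: measurable_realfun.measurable_funD.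
  apply: measurable_realfun.measurable_funM => //.
  by apply: (measurableT_comp (measurable_powR q)); exact: measurableT_comp.
have H : {within D, continuous (F \o x)}.
  by apply: within_continuous_comp cx => z _; exact: cF.
by apply: subspace_continuous_measurable_fun => //; exact: H.
Qed.

Lemma cost_split (h : R) (x0 : 'cV[R]_n) u x : 0 <= h ->
  Lq_control q u -> trajectory x0 u x ->
  (cost q F u x = cost_on h u x + cost q F (fun t => u (t + h)%R) (fun t => x (t + h)%R))%E.
Proof.
move=> h0 /(Lq_controlE hq)[mu_ _] [cx _].
apply: (ge0_integral_split h0); last by move=> t; rewrite lee_fin running_cost_ge0.
exact: measurable_running_cost.
Qed.

Lemma V_infty_ext_le (x0 : 'cV[R]_n) u x : Lq_control q u -> trajectory x0 u x ->
  (V_infty_ext q F x0 <= cost q F u x)%E.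
Proof. by move=> Lu tx; apply: ereal_inf_lbound; exists u, x. Qed.

Lemma V_infty_ext_ge0 (x0 : 'cV[R]_n) : (0 <= V_infty_ext q F x0)%E.
Proof. by apply: le_ereal_inf_tmp => _ [u [x [_ _ ->]]]; exact: cost_ge0. Qed.

(** The tail of an admissible pair is admissible from [x h], so its cost is at least the value
    there. *)
Lemma dpp_ge (h : R) (x0 : 'cV[R]_n) u x : 0 <= h ->
  Lq_control q u -> trajectory x0 u x ->
  (cost_on h u x + V_infty_ext q F (x h) <= cost q F u x)%E.
Proof.
move=> h0 Lu tx; rewrite (cost_split h0 Lu tx) leeD2l//.
by have [? ?] := admissible_shift hq h0 Lu tx; exact: V_infty_ext_le.
Qed.

Lemma eq_Rintegral_co (h : R) (f g : R -> R) : 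
  mu.-integrable `[(0:R), h] (EFin \o f) ->
  (forall t, 0 <= t < h -> f t = g t) ->
  \int[mu]_(t in `[0, h]) f t = \int[mu]_(t in `[0, h]) g t.
Proof.
move=> If fg.
have If' : mu.-integrable `[(0:R), h[ (EFin \o f).
  by apply: integrableS If => // t /=; rewrite !in_itv/=; lra.
have fg' : {in `[(0:R), h[%classic, f =1 g}.
  by move=> t; rewrite inE/= in_itv/=; exact: fg.
rewrite -Rintegral_itv_bndo_bndc// -Rintegral_itv_bndo_bndc; first exact: eq_Rintegral.
by apply: eq_integrable If' => // t /fg' /= ->.
Qed.

Lemma cost_eq u v x y : {in `[0, +oo[, u =1 v} -> {in `[0, +oo[, x =1 y} ->
  cost q F u x = cost q F v y.
Proof.
move=> uv xy; apply: eq_integral => t; rewrite inE/= => t0.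
by rewrite uv// xy.
Qed.

Lemma admissible_eq (x0 : 'cV[R]_n) u v x y :
  {in `[0, +oo[, u =1 v} -> {in `[0, +oo[, x =1 y} ->
  Lq_control q u -> trajectory x0 u x -> Lq_control q v /\ trajectory x0 v y.
Proof.
move=> uv xy Lu tx; split.
  move: Lu; rewrite /Lq_control (_ : u \_ _ = v \_ `[0, +oo[)//.
  by apply/funext => t; rewrite /patch; case: ifPn => //; rewrite inE; exact: uv.
case: tx => cx H; split.
  apply: subspace_eq_continuous cx => t; rewrite inE; exact: xy.
move=> t t0 i; rewrite -xy ?in_itv/= ?t0// H//; congr (_ + _).
apply: eq_Rintegral => s; rewrite inE/= in_itv/= => /andP[s0 _].
by rewrite uv ?xy// in_itv/= s0.
Qed.

(** Controls are compared on [[0, h[] only, since a concatenated control already takes its second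
    branch at time [h]; the states must agree at [h] too. *)
Lemma solves_on_eq (h : R) u v x y : Lq_on q `[0, h] u ->
  (forall t, 0 <= t < h -> u t = v t) -> (forall t, 0 <= t <= h -> x t = y t) ->
  solves_on h u x -> Lq_on q `[0, h] v /\ solves_on h v y.
Proof.
move=> Lu uv xy [cx H]; have [mu_ fin] := Lu.
have uvq t : 0 <= t < h -> `|u t| `^ q = `|v t| `^ q by move=> /uv ->.
have muq := measurable_Lq q mu_.
have mv : measurable_fun `[(0:R), h] v.
  apply/measurable_fun_itv_bndo_bndcP; have := (measurable_fun_itv_bndo_bndcP _ _ _).2 mu_.
  by apply: eq_measurable_fun => t; rewrite inE/= in_itv/= => /uv.
split.
  split=> //; rewrite -integral_itv_bndo_bndc; last first.
    by apply: measurable_Lq; apply/measurable_fun_itv_bndo_bndcP.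
  move: fin; rewrite -integral_itv_bndo_bndc; last first.
    by apply: measurable_Lq; apply/measurable_fun_itv_bndo_bndcP.
  apply: le_lt_trans; rewrite le_eqVlt; apply/orP; left; apply/eqP.
  by apply: eq_integral => t; rewrite inE/= in_itv/= => /uv ->.
split.
  by apply: subspace_eq_continuous cx => t; rewrite inE/= in_itv/=; exact: xy.
move=> t /andP[t0 th] i; rewrite -!xy ?lexx ?t0 ?(le_trans t0 th)// H ?t0//; congr (_ + _).
have sub : `[0, t] `<=` `[0, h] by move=> s /=; rewrite !in_itv/=; lra.
apply: eq_Rintegral_co.
  apply: (ctrl_rhs_integrable hq); first exact: (Lq_onS _ _ sub Lu).
  exact: continuous_subspaceW cx.
by move=> s /andP[s0 st]; rewrite uv ?xy ?s0/= ?(lt_le_trans st)// ltW ?(lt_le_trans st).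
Qed.

Lemma eq_cost_on (h : R) u v x y : Lq_on q `[0, h] u -> solves_on h u x ->
  Lq_on q `[0, h] v -> solves_on h v y ->
  (forall t, 0 <= t < h -> u t = v t) -> (forall t, 0 <= t <= h -> x t = y t) ->
  cost_on h u x = cost_on h v y.
Proof.
move=> [mu_ _] [cx _] [mv _] [cy _] uv xy.
have sub : `[0, h[ `<=` `[0, h] by move=> s /=; rewrite !in_itv/=; lra.
have := measurable_running_cost (measurable_itv _) mu_ cx.
have := measurable_running_cost (measurable_itv _) mv cy.
move=> /(measurable_funS (measurable_itv _) sub) m1.
move=> /(measurable_funS (measurable_itv _) sub) m2.
rewrite /cost_on -integral_itv_bndo_bndc// -[RHS]integral_itv_bndo_bndc//.
apply: eq_integral => t; rewrite inE/= in_itv/= => /andP[t0 th].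
by rewrite /running_cost uv ?xy ?t0//= ltW.
Qed.

(** Follow [u] up to [h], then a nearly optimal control from [x h]; the concatenation competes in
    the infimum at [x 0]. *)
Lemma dpp_le (h : R) u x : 0 <= h -> Lq_on q `[0, h] u -> solves_on h u x ->
  (V_infty_ext q F (x 0%R) <= cost_on h u x + V_infty_ext q F (x h))%E.
Proof.
move=> h0 Lu sx.
have key v y : Lq_control q v -> trajectory (x h) v y ->
    (V_infty_ext q F (x 0%R) <= cost_on h u x + cost q F v y)%E.
  move=> Lv ty.
  (* At [t = h] the control jumps to [v 0], while the state is continuous because [y 0 = x h]. *)
  pose w t := if t < h then u t else v (t - h).
  pose z t := if t < h then x t else y (t - h).
  have y0 : y 0 = x h by exact: trajectory0 ty.
  have wu t : 0 <= t < h -> u t = w t by move=> /andP[_]; rewrite /w => ->.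
  have zx t : 0 <= t <= h -> x t = z t.
    move=> /andP[_]; rewrite /z le_eqVlt => /predU1P[->|->//].
    by rewrite ltxx subrr.
  have wv : {in `[0, +oo[, v =1 (fun t => w (t + h))}.
    by move=> t; rewrite in_itv/= andbT => t0; rewrite /w ltNge lerDr t0/= addrK.
  have zy : {in `[0, +oo[, y =1 (fun t => z (t + h))}.
    by move=> t; rewrite in_itv/= andbT => t0; rewrite /z ltNge lerDr t0/= addrK.
  have [Lw sz] := solves_on_eq Lu wu zx sx.
  have [Lwv tzy] := admissible_eq wv zy Lv ty.
  rewrite zx ?lexx ?h0// in tzy.
  have [Lw' tz] := admissible_glue hq h0 Lw sz Lwv tzy.
  rewrite (zx 0) ?lexx ?h0//; apply: le_trans (V_infty_ext_le Lw' tz) _.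
  by rewrite (cost_split h0 Lw' tz) -(eq_cost_on Lu sx Lw sz wu zx) -(cost_eq wv zy).
(* Finiteness of the value cannot be assumed here: it is itself derived from this lemma. *)
have [->|fin] := eqVneq (V_infty_ext q F (x h)) +oo%E.
  by rewrite addey ?leey// gt_eqF// (lt_le_trans _ (cost_on_ge0 _ _ _)).
have finV : V_infty_ext q F (x h) \is a fin_num.
  by rewrite ge0_fin_numE ?V_infty_ext_ge0// lt_neqAle fin leey.
apply/lee_addgt0Pr => eps e0.
have [c [v [y [Lv ty ->]]] lt] := lb_ereal_inf_adherent e0 finV.
by rewrite -addeA (le_trans (key v y Lv ty))// leeD2l// ltW.
Qed.
End DynamicProgramming.

(** * Polynomial trajectories *)

Section PolynomialTrajectories.
Variables (R : realType) (n : nat) (q : R).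
Hypotheses (hn : (0 < n)%N) (hq : 1 < q).
Notation mu := (@lebesgue_measure R).
Notation J := (jordan_block R n).
Notation e := (e_last R n).

(** The system is a chain of integrators, so the derivatives of order below [n] of any [p] form a
    trajectory, with control the n-th derivative. *)
Definition poly_state (p : {poly R}) (t : R) : 'cV[R]_n := \col_i (p^`(i)).[t].

Lemma Rintegral_deriv (p : {poly R}) (t : R) : 0 <= t ->
  \int[mu]_(s in `[0, t]) (p^`()).[s] = p.[t] - p.[0].
Proof.
rewrite le_eqVlt => /predU1P[<-|t0]; first by rewrite set_itv1 Rintegral_set1 subrr.
rewrite /Rintegral (continuous_FTC2 (F := horner p) t0)//.
- by apply: continuous_subspaceT => s; exact: continuous_horner.
- split=> [s _||]; first exact: derivable_horner.
  + by apply: cvg_at_right_filter; exact: continuous_horner.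
  + by apply: cvg_at_left_filter; exact: continuous_horner.
- by move=> s _; rewrite derivE.
Qed.

Lemma poly_state_continuous p : continuous (poly_state p).
Proof.
move=> t A [P HP sPA].
have H : \forall s \near t, forall i j, P i j (poly_state p s i j).
  apply: (@filter_forall R 'I_n
    (fun i s => forall j, P i j (poly_state p s i j)) (nbhs t) _) => i.
  apply: (@filter_forall R 'I_1 (fun j s => P i j (poly_state p s i j)) (nbhs t) _) => j.
  have := HP i j; rewrite mxE => Pn.
  have H : nbhs t [set s | P i j (p^`(i)).[s]] := @continuous_horner R p^`(i) t _ Pn.
  by apply: filterS H => s /=; rewrite mxE.
by apply: filterS H => s Hs; exact: sPA.
Qed.

Lemma ctrl_rhs_poly p (s : R) (i : 'I_n) :
  (J *m poly_state p s + (p^`(n)).[s] *: e) i 0 = (p^`(i.+1)).[s].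
Proof.
rewrite ctrl_rhsE jordan_mulE; case: insubP => [j _ ji|]; rewrite -?leqNgt.
  rewrite mxE ji; case: eqP => [E|_]; last by rewrite mulr0 addr0.
  by have := ltn_ord j; rewrite ji E prednK// ltnn.
move=> ni; have E : i.+1 = n by apply/eqP; rewrite eqn_leq ni ltn_ord.
have En : (i : nat) = n.-1 by have := congr1 predn E.
by rewrite En eqxx mulr1 add0r prednK.
Qed.

Lemma poly_solves (h : R) p :
  Lq_on q `[0, h] (horner p^`(n)) /\ solves_on h (horner p^`(n)) (poly_state p).
Proof.
split; last split.
- have cp : {within `[0, h], continuous (horner p^`(n))}.
    by apply: continuous_subspaceT => s; exact: continuous_horner.
  have mp : measurable_fun `[(0:R), h] (horner p^`(n)).
    exact: subspace_continuous_measurable_fun.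
  split => //.
  (* [compact_bounded] makes every real above [M] a bound, whence the choice [M + 1]. *)
  have [M [_ HM]] := compact_bounded (continuous_compact cp (@segment_compact R 0 h)).
  have bM s : 0 <= s <= h -> `|(p^`(n)).[s]| <= M + 1.
    by move=> sh; apply: (HM (M + 1)); rewrite ?ltrDl//; exists s => //=; rewrite in_itv.
  have Mq : (\int[mu]_(t in `[0%R, h]) (`|(p^`(n)).[t]| `^ q)%:E <=
      \int[mu]_(t in `[0%R, h]) ((M + 1) `^ q)%:E)%E.
    apply: ge0_le_integral => //.
    - exact: measurable_Lq.
    - move=> s /=; rewrite in_itv/= => sh; rewrite lee_fin ge0_ler_powR ?nnegrE//.
      + by rewrite ltW// (lt_trans _ hq).
      + exact: le_trans (bM _ sh).
      + exact: bM.
  apply: (le_lt_trans Mq).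
  rewrite integral_cst//= lte_mul_pinfty ?lee_fin ?powR_ge0//.
  by apply: compact_finite_measure; exact: segment_compact.
- by apply: continuous_subspaceT; exact: poly_state_continuous.
move=> t /andP[t0 _] i; rewrite !mxE.
under eq_Rintegral do rewrite ctrl_rhs_poly derivnS.
by rewrite Rintegral_deriv// subrKC.
Qed.

(** Differentiating lowers the multiplicity of the root by at most one and keeps the shape power
    times cofactor; hence the induction with [r] general. *)
Lemma derivn_expr_root (a : R) (r : {poly R}) (m i : nat) : (i < m)%N ->
  ((('X - a%:P) ^+ m * r)^`(i)).[a] = 0.
Proof.
elim: i m r => [|i IH] [//|m] r im; first by rewrite derivn0 !hornerE subrr expr0n/= mul0r.
rewrite derivSn derivM deriv_exp derivB derivX derivC subr0 mul1r/=.
rewrite mulrnAl -mulrnAr exprS -mulrA mulrCA -mulrDr.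
exact: IH.
Qed.

(** Taylor polynomial at 0 with prescribed derivatives; the default 0 in the [insub] match is never
    reached for [i < n]. *)
Definition jet_poly (y : 'cV[R]_n) : {poly R} :=
  \poly_(i < n) ((if insub i is Some j then y j 0 else 0) / i`!%:R).

Lemma derivn_jet_poly y (i : 'I_n) : ((jet_poly y)^`(i)).[0] = y i 0.
Proof.
rewrite horner_coef0 coef_derivn addn0 ffactnn coef_poly ltn_ord valK.
by rewrite -[LHS]mulr_natr divfK// pnatr_eq0 -lt0n fact_gt0.
Qed.

(** Hermite interpolation by Bezout: [u * ('X - 1%:P) ^+ n] is 0 modulo [('X - 1%:P) ^+ n] and 1
    modulo ['X ^+ n]. Multiplied by the Taylor polynomial of [y], it has the required jets at both
    ends. *)
Lemma steering_poly (y : 'cV[R]_n) :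
  exists p, poly_state p 0 = y /\ poly_state p 1 = 0.
Proof.
have : coprimep (('X - 1%:P) ^+ n : {poly R}) (('X - 0%:P) ^+ n).
  by rewrite coprimep_pexpl// coprimep_pexpr// coprimep_XsubC root_XsubC eq_sym oner_eq0.
case/Bezout_eq1_coprimepP => -[u v] /= uv.
exists (u * ('X - 1%:P) ^+ n * jet_poly y); split; apply/colP => i; rewrite !mxE.
  have -> : u * ('X - 1%:P) ^+ n = 1 - v * ('X - 0%:P) ^+ n by rewrite -uv addrK.
  rewrite mulrBl mul1r mulrAC mulrC derivnB hornerD hornerN derivn_jet_poly.
  by rewrite derivn_expr_root// subr0.
by rewrite mulrAC mulrC derivn_expr_root.
Qed.

End PolynomialTrajectories.

(** * Short-time estimates *)

Section Estimates.
Variables (R : realType) (n : nat) (q : R) (F : 'cV[R]_n -> R).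
Hypotheses (hn : (0 < n)%N) (hq : 1 < q) (cF : continuous F) (F0 : forall y, 0 <= F y).
Notation mu := (@lebesgue_measure R).
Notation J := (jordan_block R n).
Notation e := (e_last R n).
Implicit Types (u v : R -> R) (x y : R -> 'cV[R]_n) (h : R).

Lemma running_cost_integrable h u x : Lq_on q `[0, h] u ->
  {within `[0, h], continuous x} ->
  mu.-integrable `[(0:R), h] (EFin \o running_cost q F u x).
Proof.
move=> Lu cx.
have I1 : mu.-integrable `[(0:R), h] (EFin \o (fun t => q^-1 * `|u t| `^ q)).
  by apply: integrable_mulrl => //; exact: Lq_on_powR_integrable.
have I2 : mu.-integrable `[(0:R), h] (EFin \o (F \o x)).
  apply: continuous_compact_integrable; first exact: segment_compact.
  have H : {within `[0, h], continuous (F \o x)}.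
    by apply: within_continuous_comp cx => z _; exact: cF.
  exact: H.
have := integrable_addr (measurable_itv _) I1 I2.
by apply: eq_integrable => // t _; rewrite /running_cost/= mulrC.
Qed.

Lemma cost_onE h u x : Lq_on q `[0, h] u ->
  {within `[0, h], continuous x} ->
  cost_on q F h u x = (\int[mu]_(t in `[0, h]) running_cost q F u x t)%:E.
Proof.
move=> Lu cx; rewrite /cost_on /Rintegral fineK//.
exact: integrable_fin_num (running_cost_integrable Lu cx).
Qed.

(** Steering to the origin on [[0, 1]] has finite cost, and staying there with zero control costs
    nothing. *)
Lemma V_infty_ext_fin_num (x0 : 'cV[R]_n) : F 0 = 0 ->
  V_infty_ext q F x0 \is a fin_num.
Proof.
move=> Fz; have [p [p0 p1]] := steering_poly hn x0.
have [Lp sp] := poly_solves hn hq 1 p.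
have := dpp_le hq cF F0 ler01 Lp sp; rewrite p0 p1 (cost_onE Lp sp.1) => le.
have L0 : Lq_control q (cst 0 : R -> R).
  apply/(Lq_controlE hq); split; first exact: measurable_cst.
  rewrite integral0_eq// => t _; rewrite normr0 powR0// gt_eqF//; exact: lt_trans hq.
have t0 : trajectory (0 : 'cV[R]_n) (cst 0) (cst 0).
  split; first by apply: continuous_subspaceT; exact: cst_continuous.
  move=> t t0 i; under eq_Rintegral do rewrite /= mulmx0 scale0r addr0 mxE.
  by rewrite Rintegral_cst// mul0r addr0.
have V0 : (V_infty_ext q F (0 : 'cV[R]_n) <= 0)%E.
  apply: le_trans (V_infty_ext_le F L0 t0) _.
  rewrite /cost integral0_eq// => t _.
  by rewrite normr0 powR0 ?mul0r ?Fz ?addr0// gt_eqF// (lt_trans _ hq).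
rewrite ge0_fin_numE ?V_infty_ext_ge0//; apply: (le_lt_trans le).
by apply: lte_add_pinfty; [exact: ltry|exact: le_lt_trans V0 _].
Qed.

Lemma ler_coord_norm (z : 'cV[R]_n) (i : 'I_n) : `|z i 0| <= `|z|.
Proof.
by rewrite [leRHS]/Num.norm/= mx_normrE;
  apply: (@le_bigmax _ _ _ _ (fun ij => `|z ij.1 ij.2|) (i, 0)).
Qed.

Lemma norm_ler_coord (z : 'cV[R]_n) (C : R) : 0 <= C ->
  (forall i, `|z i 0| <= C) -> `|z| <= C.
Proof.
move=> C0 H; rewrite [leLHS]/Num.norm/= mx_normrE; apply/bigmax_leP; split => // -[i j] _ /=.
by rewrite ord1.
Qed.

(** The norm is the maximum of the coordinates, and a shift does not increase it. *)
Lemma jordan_coord_le (z : 'cV[R]_n) (i : 'I_n) : `|(J *m z) i 0| <= `|z|.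
Proof.
by rewrite jordan_mulE; case: insub => [j|]; rewrite ?normr0 ?ler_coord_norm.
Qed.

Lemma Lq_on_norm_integrable h u : Lq_on q `[0, h] u ->
  mu.-integrable `[(0:R), h] (EFin \o (fun t => `|u t|)).
Proof.
move=> Lu; have := Lq_on_integrable hq Lu => I1.
apply: le_integrable I1 => //.
  by apply/measurable_EFinP; apply: measurableT_comp => //; case: Lu.
by move=> t _; rewrite /= normr_id.
Qed.

Lemma ge0_Rintegral_subset (A B : set R) (f : R -> R) : measurable A -> measurable B ->
  A `<=` B -> mu.-integrable B (EFin \o f) -> (forall t, 0 <= f t) ->
  \int[mu]_(t in A) f t <= \int[mu]_(t in B) f t.
Proof.
move=> mA mB AB If f0; rewrite /Rintegral fine_le//.
- by apply: integrable_fin_num => //; exact: integrableS If.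
- exact: integrable_fin_num If.
- by apply: ge0_subset_integral => //; [exact: (measurable_int mu)|move=> t _; rewrite lee_fin].
Qed.

(** Replaces Gronwall's inequality: the largest deviation [M] on [[0, h]] reappears on the right
    with the small factor [h] and is absorbed. *)
Lemma state_deviation h u x : 0 <= h <= 2^-1 ->
  Lq_on q `[0, h] u -> solves_on h u x ->
  forall t, 0 <= t <= h ->
  `|x t - x 0| <= 2 * (h * `|x 0| + \int[mu]_(s in `[0, h]) `|u s|).
Proof.
move=> /andP[h0 h2] Lu [cx H].
have cd : {within `[0, h], continuous ((fun z : 'cV[R]_n => `|z - x 0|) \o x)}.
  apply: within_continuous_comp cx => z _.
  apply: (@continuous_comp _ _ _ (fun w : 'cV[R]_n => w - x 0) Num.norm).
    by apply: continuousB; [exact: cvg_id|exact: cst_continuous].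
  exact: norm_continuous.
have [tm /= tmh Hm] := EVT_max h0 cd.
set M := `|x tm - x 0|; set a := Rintegral _ _ _.
have a0 : 0 <= a by apply: Rintegral_ge0 => s _.
(* Since [h <= 2^-1], the term [h * M] is at most half of [M]; this produces the factor 2. *)
suff HM : M <= h * M + h * `|x 0| + a.
  move=> t th; apply: (@le_trans _ _ M); first by apply: Hm; rewrite in_itv.
  have M0 : 0 <= M by exact: normr_ge0.
  have : h * M <= 2^-1 * M by rewrite ler_wpM2r.
  by lra.
have /andP[tm0 tmh'] : 0 <= tm <= h by move: tmh; rewrite in_itv.
apply: norm_ler_coord; first by rewrite !addr_ge0// mulr_ge0// normr_ge0.
move=> i; rewrite !mxE H ?tm0// addrC addKr.
have sub : `[0, tm] `<=` `[0, h] by move=> s /=; rewrite !in_itv/=; lra.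
have I1 : mu.-integrable `[(0:R), h] (EFin \o (fun s => (M + `|x 0|) + `|u s|)).
  apply: integrable_addr => //; first exact: integrable_itv_cst.
  exact: Lq_on_norm_integrable.
have Irhs : mu.-integrable `[(0:R), tm] (EFin \o (fun s => (J *m x s + u s *: e) i 0)).
  apply: (ctrl_rhs_integrable hq); first exact: (Lq_onS _ _ sub Lu).
  exact: continuous_subspaceW cx.
apply: le_trans (le_normr_Rintegral _ Irhs) _ => //.
apply: (@le_trans _ _ (\int[mu]_(s in `[0, tm]) ((M + `|x 0|) + `|u s|))).
  apply: le_Rintegral => //.
  - exact: integrable_norm Irhs.
  - exact: integrableS I1.
  move=> s /=; rewrite in_itv/= => /andP[s0 stm].
  rewrite ctrl_rhsE; apply: le_trans (ler_normD _ _) _; apply: lerD.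
    apply: le_trans (jordan_coord_le _ _) _.
    rewrite -lerBlDr; apply: le_trans (lerB_dist _ _) _.
    by apply: Hm; rewrite in_itv/= s0 (le_trans stm).
  by rewrite normrM ler_piMr//; case: (_ == _); rewrite ?normr1 ?normr0.
apply: (@le_trans _ _ (\int[mu]_(s in `[0, h]) ((M + `|x 0|) + `|u s|))).
  by apply: ge0_Rintegral_subset => // s; rewrite !addr_ge0// normr_ge0.
rewrite RintegralD//; last 2 first.
- exact: integrable_itv_cst.
- exact: Lq_on_norm_integrable.
by rewrite Rintegral_itv_cst// mulrDl [M * h]mulrC [_ * h]mulrC.
Qed.

(** Only the drift is frozen at [x 0], with error at most [rho] per coordinate and unit of time. The
    control term is kept exact, so no pointwise bound on [u] is needed. *)
Lemma linear_deviation h u x (p : 'I_n -> R) (rho : R) : 0 <= h ->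
  Lq_on q `[0, h] u -> solves_on h u x ->
  (forall t, 0 <= t <= h -> `|x t - x 0| <= rho) ->
  `|\sum_i p i * (x h - x 0) i 0 - h * (\sum_i p i * (J *m x 0) i 0)
    - (\sum_i p i * e i 0) * \int[mu]_(s in `[0, h]) u s| <= h * rho * \sum_i `|p i|.
Proof.
move=> h0 Lu [cx H] Hrho.
rewrite mulr_suml !mulr_sumr -!sumrB; apply: le_trans (ler_norm_sum _ _ _) _.
apply: ler_sum => i _.
have Iu := Lq_on_integrable hq Lu.
have IJ := jordan_coord_integrable i cx.
have -> : p i * (x h - x 0) i 0 - h * (p i * (J *m x 0) i 0) -
    p i * e i 0 * \int[mu]_(s in `[0, h]) u s =
    p i * \int[mu]_(s in `[0, h]) ((J *m x s) i 0 - (J *m x 0) i 0).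
  rewrite RintegralB//; last exact: integrable_itv_cst.
  rewrite Rintegral_itv_cst// mxE (H h) ?h0 ?lexx// mxE.
  have -> : \int[mu]_(s in `[0, h]) (J *m x s + u s *: e) i 0 =
      \int[mu]_(s in `[0, h]) (J *m x s) i 0 + e i 0 * \int[mu]_(s in `[0, h]) u s.
    rewrite -RintegralZl// -RintegralD//; last exact: integrable_mulrl.
    by apply: eq_Rintegral => s _; rewrite mxE [in X in _ + X]mxE [u s * _]mulrC.
  ring.
rewrite normrM mulrC ler_wpM2r//.
have Id : mu.-integrable `[(0:R), h] (EFin \o (fun s => (J *m x s) i 0 - (J *m x 0) i 0)).
  by apply: integrable_addr => //; exact: integrable_itv_cst.
apply: le_trans (le_normr_Rintegral _ Id) _ => //.
rewrite mulrC -Rintegral_itv_cst//; apply: le_Rintegral => //.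
- exact: integrable_norm Id.
- exact: integrable_itv_cst.
move=> s /=; rewrite in_itv/= => sh.
have -> : (J *m x s) i 0 - (J *m x 0) i 0 = (J *m (x s - x 0)) i 0.
  by rewrite mulmxBr [RHS]mxE [in X in _ = _ + X]mxE.
exact: le_trans (jordan_coord_le _ _) (Hrho _ sh).
Qed.

End Estimates.

(** * Young's inequality and differentiability *)

Section Young.
Variables (R : realType) (q : R).
Hypothesis hq : 1 < q.

Let q0 : 0 < q. Proof. exact: lt_trans hq. Qed.
Let q10 : 0 < q - 1. Proof. by rewrite subr_gt0. Qed.

Lemma young (a b : R) : 0 <= a -> 0 <= b ->
  a * b <= a `^ q / q + (q - 1) / q * b `^ (q / (q - 1)).
Proof.
move=> a0 b0; rewrite [_ * b `^ _]mulrC.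
have -> : (q - 1) / q = (q / (q - 1))^-1 by rewrite invf_div.
apply: conjugate_powR => //; first by rewrite divr_gt0.
by rewrite invf_div; field; rewrite gt_eqF.
Qed.

(** Young's inequality for [k * a] and [k^-1], with [k] chosen so that the q-th power of [k] divided
    by [q] equals [eta]. *)
Lemma ler_powR_affine (eta : R) : 0 < eta ->
  exists2 C, 0 <= C & forall a, 0 <= a -> a <= eta * a `^ q + C.
Proof.
move=> eta0; pose k := (eta * q) `^ q^-1.
have k0 : 0 < k by rewrite powR_gt0// mulr_gt0.
exists ((q - 1) / q * k^-1 `^ (q / (q - 1))).
  by rewrite mulr_ge0 ?powR_ge0// divr_ge0 ?ltW.
move=> a a0; have := @young (k * a) k^-1.
rewrite mulr_ge0 ?invr_ge0 ?(ltW k0)// => /(_ erefl erefl).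
rewrite mulrAC divff ?gt_eqF// mul1r powRM// ?(ltW k0)//.
rewrite -powRrM mulVf ?gt_eqF// powRr1; last by rewrite mulr_ge0// ltW.
by rewrite [eta * q * _]mulrAC mulfK ?gt_eqF.
Qed.

Lemma young_equality (b : R) :
  exists c, `|c| `^ q / q + b * c = - ((q - 1) / q * `|b| `^ (q / (q - 1))).
Proof.
(* The critical point of the convex function of [c] on the left. *)
exists (- Num.sg b * `|b| `^ (q - 1)^-1).
have [->|b0] := eqVneq b 0.
  by rewrite sgr0 !(oppr0, mul0r, normr0) !powR0 ?mul0r ?mulr0 ?addr0 ?oppr0//
    gt_eqF// divr_gt0.
rewrite normrM normrN normr_sg b0 mul1r (ger0_norm (powR_ge0 _ _)) -powRrM.
have -> : (q - 1)^-1 * q = q / (q - 1) by rewrite mulrC.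
have -> : b * (- Num.sg b * `|b| `^ (q - 1)^-1) = - `|b| `^ (q / (q - 1)).
  rewrite mulrA mulrN mulNr [b * _]mulrC -normrEsg; congr (- _).
  have -> : q / (q - 1) = 1 + (q - 1)^-1 by field; rewrite gt_eqF.
  by rewrite powRD ?powRr1//; apply/implyP => _; rewrite normr_eq0.
by field; rewrite gt_eqF.
Qed.

Lemma powR_cvg_right (a r : R) : 0 <= a -> 0 < r ->
  (a + x) `^ r @[x --> 0^'+] --> a `^ r.
Proof.
(* At [a = 0] the power may fail to be differentiable, so its right limit is taken directly. *)
rewrite le_eqVlt => /predU1P[<-|a0] r0.
  rewrite powR0 ?gt_eqF//; under eq_fun do rewrite add0r.
  exact: powR_cvg0.
apply: cvg_at_right_filter.
have c1 : {for a, continuous (fun x : R => x `^ r)}.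
  apply: differentiable_continuous; apply/derivable1_diffP.
  by apply: derivable_powR; rewrite in_itv/= a0.
have : {for 0, continuous ((fun x : R => x `^ r) \o (fun x => a + x))}.
  apply: continuous_comp; last by rewrite addr0.
  by apply: cvgD; [exact: cvg_cst|exact: cvg_id].
by rewrite /prop_for /continuous_at /= addr0.
Qed.
End Young.

Section Gradient.
Variables (R : realType) (n : nat).

Lemma diff_sum_partial (f : 'cV[R]_n -> R) (x0 v : 'cV[R]_n) : differentiable f x0 ->
  'd f x0 v = \sum_i 'D_(delta_mx i 0) f x0 * v i 0.
Proof.
move=> df.
have -> : v = \sum_i v i 0 *: delta_mx i 0.
  by apply/colP => i; rewrite summxE (bigD1 i)//= !mxE eqxx mulr1 big1 ?addr0// => j ji;
    rewrite !mxE eq_sym (negbTE ji) mulr0.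
rewrite linear_sum; apply: eq_bigr => i _; rewrite linearZ/= deriveE//.
rewrite summxE (bigD1 i)//= !mxE eqxx mulr1 big1 ?addr0; first by rewrite mulrC.
by move=> j ji; rewrite !mxE eq_sym (negbTE ji) mulr0.
Qed.

Lemma differentiable_expansion (f : 'cV[R]_n -> R) (x0 : 'cV[R]_n) (d : R) :
  differentiable f x0 -> 0 < d ->
  exists2 rho, 0 < rho & forall y, `|y - x0| < rho ->
   `|f y - f x0 - \sum_i 'D_(delta_mx i 0) f x0 * (y - x0) i 0| <= d * `|y - x0|.
Proof.
move=> df d0; have /eqaddoP := diff_locally df => /(_ _ d0)/nbhs_norm0P[rho /= rho0 H].
exists rho => // y yx; have := H _ yx; rewrite /= -diff_sum_partial//.
by rewrite !fctE/= subrK opprD addrA.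
Qed.
End Gradient.

(** * The two inequalities *)

Section HJB.
Variables (R : realType) (n : nat) (q : R) (F : 'cV[R]_n -> R).
Hypotheses (hn : (0 < n)%N) (hq : 1 < q).
Hypotheses (cF : continuous F) (F0 : forall y, 0 <= F y) (Fz : F 0 = 0).
Notation mu := (@lebesgue_measure R).
Notation J := (jordan_block R n).
Notation e := (e_last R n).
Notation V := (V_infty q F).
Notation partial x0 i := ('D_(delta_mx i 0) V x0).
Implicit Types (u : R -> R) (x : R -> 'cV[R]_n).

Let q0 : 0 < q. Proof. exact: lt_trans hq. Qed.

Lemma V_infty_extE (x0 : 'cV[R]_n) : V_infty_ext q F x0 = (V x0)%:E.
Proof. by rewrite /V_infty fineK// V_infty_ext_fin_num. Qed.

Lemma V_infty_ge0 (x0 : 'cV[R]_n) : 0 <= V x0.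
Proof. by rewrite -lee_fin -V_infty_extE; exact: V_infty_ext_ge0. Qed.

Lemma bellman_le (h : R) u x : 0 <= h -> Lq_on q `[0, h] u -> solves_on h u x ->
  V (x 0) <= \int[mu]_(t in `[0, h]) running_cost q F u x t + V (x h).
Proof.
move=> h0 Lu sx; rewrite -lee_fin EFinD -!V_infty_extE -(cost_onE cF Lu sx.1).
exact: dpp_le.
Qed.

Lemma bellman_ge (h eps : R) (x0 : 'cV[R]_n) : 0 <= h -> 0 < eps ->
  exists u x, [/\ Lq_on q `[0, h] u, solves_on h u x, x 0 = x0 &
    \int[mu]_(t in `[0, h]) running_cost q F u x t + V (x h) <= V x0 + eps].
Proof.
move=> h0 e0; have finV := V_infty_ext_fin_num hn hq cF F0 x0 Fz.
have [_ [u [x [Lu tx ->]]] lt] := lb_ereal_inf_adherent e0 finV.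
have [Lh sx] := admissible_restrict hq h0 Lu tx.
exists u, x; split => //; first exact: trajectory0 tx.
rewrite -lee_fin !EFinD -!V_infty_extE -(cost_onE cF Lh sx.1).
exact: le_trans (dpp_ge hq cF F0 h0 Lu tx) (ltW lt).
Qed.

(** * The two Hamiltonian inequalities at a point of differentiability *)

Section AtPoint.
Variable x0 : 'cV[R]_n.
Hypothesis dV : differentiable V x0.

Let S : R := \sum_i partial x0 i * (J *m x0) i 0.
Let P : R := \sum_i `|partial x0 i|.
Let pn : R := \sum_i partial x0 i * e i 0.

Let P0 : 0 <= P. Proof. by apply: sumr_ge0. Qed.

Lemma local_expansion (d : R) : 0 < d -> exists2 rho, 0 < rho <= d &
  forall y, `|y - x0| <= rho -> `|F y - F x0| <= d /\
   `|V y - V x0 - \sum_i partial x0 i * (y - x0) i 0| <= d * `|y - x0|.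
Proof.
move=> d0; have [r1 r10 H1] := differentiable_expansion dV d0.
have /cvgrPdist_le /(_ _ d0) : F y @[y --> x0] --> F x0 by exact: cF.
move=> /nbhs_ballP[r2 /= r20 H2].
(* Halving turns the strict radii into a non-strict one; the bound by [d] lets the drift error
   [h * rho * P] be replaced by [h * d * P]. *)
exists (Num.min d (Num.min r1 r2 / 2)).
  by rewrite lt_min d0 divr_gt0 ?lt_min ?r10//= ge_min lexx.
move=> y; rewrite le_min => /andP[_ yr].
have yr' : `|y - x0| < Num.min r1 r2.
  by apply: le_lt_trans yr _; rewrite ltr_pdivrMr// ltr_pMr ?ltr1n// lt_min r10.
move: yr'; rewrite lt_min => /andP[y1 y2]; split; last exact: H1.
by rewrite distrC; apply: H2; rewrite -ball_normE/= distrC.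
Qed.

Lemma hamiltonian_ge0 : 0 <= S - (q - 1) / q * `|pn| `^ (q / (q - 1)) + F x0.
Proof.
have [c Ec] := young_equality hq pn.
set H := (X in 0 <= X).
have HE : H = S + (`|c| `^ q / q + pn * c) + F x0 by rewrite Ec.
pose K := 1 + P + 2 * (`|x0| + `|c|).
have K0 : 0 < K by rewrite !ltr_wpDr// mulr_ge0// addr_ge0.
apply/ler_addgt0Pr => eps eps0.
pose d := eps / K; have d0 : 0 < d by rewrite divr_gt0.
have [rho /andP[rho0 rhod] Hrho] := local_expansion d0.
(* The bound [2^-1] is what [state_deviation] asks; the other keeps the trajectory within [rho] of
   [x0], the added 1 making the denominator positive. *)
pose h := Num.min 2^-1 (rho / (2 * (`|x0| + `|c| + 1))).
have D0 : 0 < 2 * (`|x0| + `|c| + 1) by rewrite mulr_gt0// ltr_wpDl// addr_ge0.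
have h0 : 0 < h by rewrite lt_min invr_gt0 ltr0n/= divr_gt0.
have h2 : h <= 2^-1 by rewrite ge_min lexx.
have hr : 2 * (h * (`|x0| + `|c|)) <= rho.
  have : h * (2 * (`|x0| + `|c| + 1)) <= rho.
    by rewrite -ler_pdivlMr// ge_min lexx orbT.
  by lra.
(* The monomial makes the n-th derivative, that is the control, constantly [c], without changing the
   lower derivatives at 0. *)
pose p := jet_poly x0 + (c / n`!%:R) *: 'X^n.
have [Lu sx] := poly_solves hn hq h p.
have p0 : poly_state n p 0 = x0.
  apply/colP => i; rewrite mxE derivnD hornerD derivn_jet_poly derivnZ derivnXn !hornerE.
  by rewrite hornerMn hornerXn expr0n subn_eq0 leqNgt ltn_ord mul0rn mulr0 addr0.
have un t : (p^`(n)).[t] = c.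
  rewrite derivnD hornerD derivn_poly0 ?size_poly// horner0 add0r derivnZ derivnXn.
  by rewrite subnn expr0 ffactnn !hornerE hornerMn hornerC divfK// pnatr_eq0 -lt0n fact_gt0.
have Iu : \int[mu]_(s in `[0, h]) (p^`(n)).[s] = c * h.
  by under eq_Rintegral do rewrite un; rewrite Rintegral_itv_cst// ltW.
have Ia : \int[mu]_(s in `[0, h]) `|(p^`(n)).[s]| = `|c| * h.
  by under eq_Rintegral do rewrite un; rewrite Rintegral_itv_cst// ltW.
set u := horner _ in Lu sx Iu Ia; set x := poly_state n p in sx p0.
have dev t : 0 <= t <= h -> `|x t - x0| <= 2 * (h * (`|x0| + `|c|)).
  move=> th; have := state_deviation hq (h := h) _ Lu sx th.
  rewrite (ltW h0) h2 => /(_ erefl); rewrite p0 Ia.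
  by move=> /le_trans; apply; lra.
have hh : 0 <= h <= h by rewrite (ltW h0) lexx.
have dev' t : 0 <= t <= h -> `|x t - x0| <= rho.
  by move=> /dev /le_trans; exact.
have := linear_deviation hq (fun i => partial x0 i) (ltW h0) Lu sx (rho := rho).
rewrite p0 => /(_ dev'); rewrite -/S -/P -/pn Iu => lin.
have [_ expd] := Hrho _ (dev' _ hh).
have := bellman_le (ltW h0) Lu sx; rewrite p0 => bel.
have cst_le : \int[mu]_(t in `[0, h]) running_cost q F u x t <=
    (`|c| `^ q / q + F x0 + d) * h.
  rewrite -(Rintegral_itv_cst _ (ltW h0)); apply: le_Rintegral => //.
  - exact: (running_cost_integrable cF Lu sx.1).
  - exact: integrable_itv_cst.
  move=> t /=; rewrite in_itv/= => th; have ut : u t = c := un t.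
  rewrite /running_cost ut -addrA lerD2l.
  have [] := Hrho _ (dev' _ th); rewrite ler_distl => /andP[_ ?] _; lra.
have devh := dev _ hh.
set L := \sum_i partial x0 i * (x h - x0) i 0 in lin expd.
have expd' : V (x h) - V x0 - L <= d * (2 * (h * (`|x0| + `|c|))).
  apply: le_trans (ler_norm _) (le_trans expd _).
  by rewrite ler_wpM2l// ltW.
have lin' : L - h * S - pn * (c * h) <= h * d * P.
  apply: le_trans (ler_norm _) (le_trans lin _).
  by rewrite ler_wpM2r// ler_wpM2l// ltW.
have : 0 <= h * (H + d * K).
  rewrite HE /K; lra.
rewrite pmulr_rge0// /d divfK ?gt_eqF//.
Qed.

Lemma hamiltonian_le_pert (d : R) : 0 < d <= 1 ->
  F x0 + S <= (q - 1) / q * (`|pn| + 2 * d) `^ (q / (q - 1)) + d * (2 + P + 2 * `|x0|).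
Proof.
move=> /andP[d0 d1].
have [rho /andP[rho0 rhod] Hrho] := local_expansion d0.
have V0 := V_infty_ge0 x0.
(* Chosen before [h], so that [8 * (eta * q * I) <= rho] for every running cost [I <= V x0 + 1].
   With the later choice of [h], the deviation is then at most [rho]. *)
pose eta := rho / (8 * q * (V x0 + 1)).
have eta0 : 0 < eta by rewrite divr_gt0// !mulr_gt0// ltr_wpDl.
have [C C0 HC] := ler_powR_affine hq eta0.
pose h := Num.min 2^-1 (rho / (8 * (`|x0| + C + 1))).
have D0 : 0 < 8 * (`|x0| + C + 1) by rewrite mulr_gt0// ltr_wpDl// addr_ge0.
have h0 : 0 < h by rewrite lt_min invr_gt0 ltr0n/= divr_gt0.
have h2 : h <= 2^-1 by rewrite ge_min lexx.
have hr : 8 * (h * (`|x0| + C)) <= rho.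
  have : h * (8 * (`|x0| + C + 1)) <= rho.
    by rewrite -ler_pdivlMr// ge_min lexx orbT.
  by lra.
have hd0 : 0 < h * d by rewrite mulr_gt0.
(* The tolerance [h * d] is proportional to [h], so it costs only [d] after division by [h]. *)
have [u [x [Lu sx xx bel]]] := bellman_ge x0 (ltW h0) hd0.
set I := Rintegral _ _ _ in bel.
have Irun := running_cost_integrable cF Lu sx.1.
have Iabs := Lq_on_norm_integrable hq Lu.
have Iuu := Lq_on_integrable hq Lu.
pose a := \int[mu]_(s in `[0, h]) `|u s|.
have a0 : 0 <= a by apply: Rintegral_ge0.
have IV : I <= V x0 + 1.
  have := V_infty_ge0 (x h).
  have : h * d <= 2^-1 * 1 by rewrite ler_pM// ltW.
  by lra.
have aI : a <= eta * q * I + C * h.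
  rewrite -(Rintegral_itv_cst C (ltW h0)) /I -RintegralZl// -RintegralD//; last 2 first.
  - exact: integrable_mulrl.
  - exact: integrable_itv_cst.
  apply: le_Rintegral => //.
    apply: integrable_addr => //; [exact: integrable_mulrl|exact: integrable_itv_cst].
  move=> s _; apply: le_trans (HC _ (normr_ge0 _)) _; rewrite lerD2r.
  have -> : eta * q * running_cost q F u x s = eta * (`|u s| `^ q + q * F (x s)).
    by rewrite /running_cost; field; rewrite gt_eqF.
  by rewrite ler_pM2l// ler_wpDr// mulr_ge0// ltW.
have aI' : 8 * (eta * q * I) <= rho.
  have -> : 8 * (eta * q * I) = rho / (V x0 + 1) * I.
    by rewrite /eta; field; rewrite !gt_eqF// ltr_wpDl.
  by rewrite mulrAC ler_pdivrMr ?ler_pM2l// ltr_wpDl.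
have dev t : 0 <= t <= h -> `|x t - x0| <= 2 * (h * `|x0| + a).
  move=> th; have := state_deviation hq (h := h) _ Lu sx th.
  by rewrite (ltW h0) h2 xx => /(_ erefl).
have hh : 0 <= h <= h by rewrite (ltW h0) lexx.
have dev' t : 0 <= t <= h -> `|x t - x0| <= rho.
  by move=> /dev /le_trans; apply; lra.
have := linear_deviation hq (fun i => partial x0 i) (ltW h0) Lu sx (rho := rho).
rewrite xx => /(_ dev'); rewrite -/S -/P -/pn => lin.
have [_ expd] := Hrho _ (dev' _ hh).
have devh := dev _ hh.
set L := \sum_i partial x0 i * (x h - x0) i 0 in lin expd.
set b := \int[mu]_(s in `[0, h]) u s in lin.
have expd' : - (d * (2 * (h * `|x0| + a))) <= V (x h) - V x0 - L.
  rewrite lerNl; apply: le_trans (ler_norm _) _; rewrite normrN.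
  by apply: le_trans expd _; rewrite ler_wpM2l// ltW.
have lin' : - (h * d * P) <= L - h * S - pn * b.
  rewrite lerNl; apply: le_trans (ler_norm _) _; rewrite normrN.
  apply: le_trans lin _.
  by rewrite ler_wpM2r// ler_wpM2l// ltW.
set Y := (q - 1) / q * _.
(* Young's inequality for [|u s|] and [|pn| + 2 * d]. The term [2 * d * a] that it yields cancels
   the same term of the remainder in [expd']. *)
have low : (F x0 - d - Y) * h <= I + (pn * b + (- (2 * d)) * a).
  rewrite -(Rintegral_itv_cst _ (ltW h0)) /a /b -!RintegralZl// -RintegralD//; last 2 first.
  - exact: integrable_mulrl.
  - exact: integrable_mulrl.
  have I2 : mu.-integrable `[(0:R), h]
      (EFin \o (fun s => pn * u s + (- (2 * d)) * `|u s|)).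
    by apply: integrable_addr => //; exact: integrable_mulrl.
  rewrite /I -RintegralD//; apply: le_Rintegral => //.
  - exact: integrable_itv_cst.
  - exact: integrable_addr.
  move=> s /=; rewrite in_itv/= => sh; rewrite /running_cost.
  have [+ _] := Hrho _ (dev' _ sh); rewrite ler_distl => /andP[Fs _].
  have := @young R q hq `|u s| (`|pn| + 2 * d) (normr_ge0 _).
  rewrite addr_ge0//; last by rewrite mulr_ge0// ltW.
  move=> /(_ erefl); rewrite -/Y mulrDr => yng.
  have : - (`|u s| * `|pn|) <= pn * u s.
    by rewrite lerNl -normrM [u s * _]mulrC -normrN ler_norm.
  by lra.
suff : h * (F x0 + S) <= h * (Y + d * (2 + P + 2 * `|x0|)) by rewrite ler_pM2l.
by lra.
Qed.

Lemma hamiltonian_le0 : S - (q - 1) / q * `|pn| `^ (q / (q - 1)) + F x0 <= 0.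
Proof.
set Y := (q - 1) / q * _.
(* The bound of [hamiltonian_le_pert] at [d / 2], which gives the base the form needed by
   [powR_cvg_right]. *)
pose g d := (q - 1) / q * (`|pn| + d) `^ (q / (q - 1)) + d * ((2 + P + 2 * `|x0|) / 2).
have cg : g d @[d --> 0^'+] --> Y.
  rewrite -[Y]addr0; apply: cvgD.
    apply: cvgM; first exact: cvg_cst.
    by apply: powR_cvg_right => //; rewrite divr_gt0// subr_gt0.
  apply: cvg_at_right_filter; rewrite -[X in _ --> X](mul0r ((2 + P + 2 * `|x0|) / 2)).
  by apply: cvgM; [exact: cvg_id|exact: cvg_cst].
suff H : F x0 + S <= Y by lra.
apply: (cvgr_to_ge cg); near=> d.
have -> : g d = (q - 1) / q * (`|pn| + 2 * (d / 2)) `^ (q / (q - 1)) +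
    d / 2 * (2 + P + 2 * `|x0|).
  by rewrite /g (_ : 2 * (d / 2) = d); [congr (_ + _); field|field].
apply: hamiltonian_le_pert; rewrite divr_gt0//= ler_pdivrMr// mul1r.
by near: d; exact: nbhs_right_le.
Unshelve. all: by end_near.
Qed.

End AtPoint.
End HJB.

Theorem theorem5p1 (R : realType) (n : nat) (hn : (1 <= n)%N) (q : R)
    (hq : 1 < q) (F : 'cV[R]_n -> R)
    (F_C1 : C1 F) (F_convex : convex_function setT F)
    (F_posdef : positive_definite F)
    (V_C1 : C1 (V_infty q F)) :
  forall x : 'cV[R]_n,
    ((grad (V_infty q F) x)^T *m (jordan_block R n *m x)) 0 0
    - (q - 1) / q * `|'D_(e_last R n) (V_infty q F) x| `^ (q / (q - 1))
    + F x = 0.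
Proof.
move=> x; have [F00 Fpos] := F_posdef.
have cF : continuous F by move=> y; apply: differentiable_continuous; exact: F_C1.1.
have F0 y : 0 <= F y by have [->|/Fpos/ltW//] := eqVneq y 0; rewrite F00.
have dV := V_C1.1 x.
have -> : ((grad (V_infty q F) x)^T *m (jordan_block R n *m x)) 0 0 =
    \sum_i 'D_(delta_mx i 0) (V_infty q F) x * (jordan_block R n *m x) i 0.
  by rewrite mxE; apply: eq_bigr => i _; rewrite !mxE.
(* The derivative along the last basis vector becomes the sum that [pn] abbreviates in the two
   inequalities. *)
rewrite deriveE// diff_sum_partial//.
apply: le_anti; rewrite hamiltonian_le0//= hamiltonian_ge0//.
Qed.
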